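(* Let $N\ge 2$ agents communicate over a fixed, undirected, connected graph; let $\mathcal N_i\neq\emptyset$ be the neighbor set of agent $i$. Fix weights $w_1,w_2,w_3>0$, a sampling period $h>0$, constants $d>0$, $\nu>0$, and for each agent bounds $\dot\delta_{i,\min}<0<\dot\delta_{i,\max}$ and $\ddot\gamma_{i,\max}>0$. Let $\delta^0_{i,1},\dot\delta^0_{i,1}\in\mathbb R$ be initial values with \[ \dot\delta_{i,\min}\le\dot\delta^0_{i,1}\le\dot\delta_{i,\max},\qquad i=1,\dots,N, \] and let $\alpha_i^k$ ($k\ge1$) be real numbers with $|\alpha_i^k|\le d\,e^{-\nu kh}$ for all $i$ and $k\ge1$. Let the sequences be generated by the constrained one-step distributed MPC scheme described in the context, and write $\bm\Delta^0=(\delta^0_{1,1},\dots,\delta^0_{N,1})^T$, $\dot{\bm\Delta}^0=(\dot\delta^0_{1,1},\dots,\dot\delta^0_{N,1})^T$. Then, for all sufficiently small $h>0$, there exist constants $\nu_h>0$ and $d_h>0$ such that, if \[ \max\{\|\bm\Delta^0\|_\infty,\|\dot{\bm\Delta}^0\|_\infty\}<\nu_h\qquad\text{and}\qquad 0<d<d_h, \] then for all $i=1,\dots,N$ and all $k\ge1$, \[ \dot\delta_{i,\min}\le\dot\delta^k_{i,1}\le\dot\delta_{i,\max},\qquad |u^k_{i,0}|\le\ddot\gamma_{i,\max}, \] and there exist $r_h\in(0,1)$, $M_0^h>0$, $\dot M_0^h>0$ such that for all $k\ge1$ and $i,j$: $|\delta^k_{i,0}-\delta^k_{j,0}|\le M_0^h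 r_h^k$ and $|\dot\delta^k_{i,0}|\le\dot M_0^h r_h^k$.
   Context: Constrained distributed MPC scheme with prediction horizon $K=1$. For $k=1,2,\dots$ and each agent $i$, set \[ \delta^k_{i,0}=\delta^{k-1}_{i,1}-\alpha_i^k,\qquad \dot\delta^k_{i,0}=\dot\delta^{k-1}_{i,1}, \] and choose $u^k_{i,0}$ as the minimizer of \[ \frac{w_1}{|\mathcal N_i|}\sum_{j\in\mathcal N_i}\big(\delta^k_{i,1}-\delta^{k-1}_{j,1}\big)^2+w_2\big(\dot\delta^k_{i,1}\big)^2+w_3u^2 \] over $u\in\mathbb R$, where \[ \delta^k_{i,1}=\delta^k_{i,0}+h\dot\delta^k_{i,0}+\tfrac{h^2}{2}u,\qquad \dot\delta^k_{i,1}=\dot\delta^k_{i,0}+hu, \] subject to the constraints \[ \dot\delta_{i,\min}\le\dot\delta^k_{i,\tau}\le\dot\delta_{i,\max}\ (\tau=0,1),\qquad |u|\le\ddot\gamma_{i,\max}. \] The resulting $\delta^k_{i,1},\dot\delta^k_{i,1}$ are then used at the next step. In the application, $\dot\delta_{i,\min}=\dot\gamma_{i,\min}-1$ and $\dot\delta_{i,\max}=\dot\gamma_{i,\max}-1$ are bounds on the virtual-time rate deviation, $\ddot\gamma_{i,\max}$ bounds the virtual-time acceleration, and $\alpha_i^k$ is a path-following correction. *)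

(* Defs.v *)
From HB Require Import structures.
From mathcomp Require Import all_boot all_order all_algebra.
From mathcomp Require Import all_classical all_reals all_analysis.
Set Implicit Arguments. Unset Strict Implicit. Unset Printing Implicit Defensive.
Import Order.TTheory GRing.Theory Num.Theory.
Local Open Scope ring_scope.

Section MPC.
Variables (R : realType) (N : nat).

Definition inf_norm (x : 'I_N -> R) : R := \big[Num.max/0]_(i < N) `|x i|.

Definition next_pos (h x v u : R) : R := x + h * v + h ^+ 2 / 2 * u.
Definition next_vel (h v u : R) : R := v + h * u.

(* cost of agent i; prev j = delta^{k-1}_{j,1}; neighbours N_i = [pred j | e i j] *)
Definition mpc_cost (e : rel 'I_N) (w1 w2 w3 h : R) (prev : 'I_N -> R)
  (i : 'I_N) (x0 v0 u : R) : R :=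
  w1 / (#|[pred j | e i j]|)%:R *
    (\sum_(j < N | e i j) (next_pos h x0 v0 u - prev j) ^+ 2)
  + w2 * (next_vel h v0 u) ^+ 2 + w3 * u ^+ 2.

Definition mpc_feasible (h vmin vmax amax v0 u : R) : Prop :=
  (vmin <= v0 <= vmax) /\ (vmin <= next_vel h v0 u <= vmax) /\ `|u| <= amax.

Definition mpc_opt (e : rel 'I_N) (w1 w2 w3 h : R) (vmin vmax amax : 'I_N -> R)
  (prev : 'I_N -> R) (i : 'I_N) (x0 v0 u : R) : Prop :=
  mpc_feasible h (vmin i) (vmax i) (amax i) v0 u /\
  forall u', mpc_feasible h (vmin i) (vmax i) (amax i) v0 u' ->
    mpc_cost e w1 w2 w3 h prev i x0 v0 u <= mpc_cost e w1 w2 w3 h prev i x0 v0 u'.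

(* Sequences generated by the scheme:
   d1 k i = delta^k_{i,1}, dd1 k i = dot delta^k_{i,1}   (k >= 0),
   d0 k i = delta^k_{i,0}, dd0 k i = dot delta^k_{i,0}, u k i = u^k_{i,0} (k >= 1). *)
Definition mpc_generated (e : rel 'I_N) (w1 w2 w3 h : R)
  (vmin vmax amax : 'I_N -> R) (D0 dD0 : 'I_N -> R) (alpha : nat -> 'I_N -> R)
  (d0 dd0 u d1 dd1 : nat -> 'I_N -> R) : Prop :=
  (forall i, d1 0%N i = D0 i /\ dd1 0%N i = dD0 i) /\
  forall (k : nat) (i : 'I_N),
    [/\ d0 k.+1 i = d1 k i - alpha k.+1 i,
        dd0 k.+1 i = dd1 k i,
        mpc_opt e w1 w2 w3 h vmin vmax amax (d1 k) i (d0 k.+1 i) (dd0 k.+1 i) (u k.+1 i),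
        d1 k.+1 i = next_pos h (d0 k.+1 i) (dd0 k.+1 i) (u k.+1 i)
      & dd1 k.+1 i = next_vel h (dd0 k.+1 i) (u k.+1 i)].

End MPC.

(* Main.v *)
(* Without the constraints every agent's problem is a strictly convex quadratic in u, so
   the scheme is linear: with p, v the stacked positions and velocities and L the
   normalised graph Laplacian,
     v' = (1 - beta) v - kappa (L p - alpha),   p' = p - alpha + (h/2) (v + v').
   L is symmetric and 0 <= L <= 2 for the degree-weighted inner product, and connectedness
   gives the gap <L p, p> <= K |L p|^2. The energy |v|^2 + c <L p, p> + eps <L p, v>
   contracts for suitable c, eps because kappa h < beta < 2, whatever h > 0 is; the
   exponentially decaying alpha then yields exponential decay of v and of the
   disagreements. For small data the linear trajectory stays strictly inside the
   constraints, hence it is the one generated by the constrained scheme, which by strict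
   convexity generates nothing else. *)
Require Import Defs.
From HB Require Import structures.
From mathcomp Require Import all_boot all_order all_algebra.
From mathcomp Require Import all_classical all_reals all_analysis.
Import Order.TTheory GRing.Theory Num.Theory.
Local Open Scope ring_scope.
From mathcomp Require Import ring lra.
Set Implicit Arguments. Unset Strict Implicit. Unset Printing Implicit Defensive.

(** * A quadratic Lyapunov function for the abstract linear scheme *)

Section Lyapunov.
Variables (R : realFieldType) (V : lmodType R) (ip : V -> V -> R) (L : V -> V).
Hypothesis ipC : forall x y, ip x y = ip y x.
Hypothesis ipDl : forall x y z, ip (x + y) z = ip x z + ip y z.
Hypothesis ipZl : forall a x y, ip (a *: x) y = a * ip x y.
Hypothesis ip_ge0 : forall x, 0 <= ip x x.
Hypothesis LD : forall x y, L (x + y) = L x + L y.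
Hypothesis LZ : forall a x, L (a *: x) = a *: L x.
Hypothesis L_sym : forall x y, ip (L x) y = ip (L y) x.
Hypothesis L_ge0 : forall x, 0 <= ip (L x) x.
Hypothesis L_le2 : forall x, ip (L x) x <= 2 * ip x x.

Let ipDr x y z : ip z (x + y) = ip z x + ip z y.
Proof. by rewrite ipC ipDl ![ip _ z]ipC. Qed.
Let ipZr a x y : ip x (a *: y) = a * ip x y.
Proof. by rewrite ipC ipZl ipC. Qed.
Let ipE := (ipDl, ipDr, ipZl, ipZr, LD, LZ).

(** Expand the form at [s x + y] and [s x - y] and divide by [s]. Only semidefiniteness enters, so
    no Cauchy-Schwarz inequality is involved. *)
Lemma form_young (s : R) x y : 0 < s ->
  - (s * ip x x + s^-1 * ip y y) <= 2 * ip x y <= s * ip x x + s^-1 * ip y y.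
Proof.
move=> s0; have sn0 : s != 0 by rewrite gt_eqF.
have sv : 0 <= s^-1 by rewrite invr_ge0 ltW.
have := mulr_ge0 sv (ip_ge0 (s *: x + (-1) *: y)).
have := mulr_ge0 sv (ip_ge0 (s *: x + y)).
rewrite !ipE (ipC y x).
set X := ip x x; set Y := ip y y; set Z := ip x y => K1 K2.
have E1 : s^-1 * (s * (s * X) + s * Z + (s * Z + Y)) = s * X + 2 * Z + s^-1 * Y.
  by field.
have E2 : s^-1 * (s * (s * X + -1 * Z) + -1 * (s * Z + -1 * Y)) =
    s * X - 2 * Z + s^-1 * Y by field.
apply/andP; split.
  suff : 0 <= s * X + 2 * Z + s^-1 * Y by lra.
  by rewrite -E1; apply: le_trans K1 _; rewrite le_eqVlt; apply/orP; left; apply/eqP; ring.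
suff : 0 <= s * X - 2 * Z + s^-1 * Y by lra.
by rewrite -E2; apply: le_trans K2 _; rewrite le_eqVlt; apply/orP; left; apply/eqP; ring.
Qed.

(** The operator bound [L^2 <= 2 L] without spectral theory: test [L_ge0] at [x - L x / 2] and bound
    the resulting [<L L x, L x>] by [L_le2]. *)
Lemma norm_L_le x : ip (L x) (L x) <= 2 * ip (L x) x.
Proof.
have := L_ge0 (x + (- 2^-1) *: L x); have := L_le2 (L x).
by rewrite !ipE (L_sym (L x) x); lra.
Qed.

(* The cross term [eps <L p, v>] makes the energy decrease also in the direction of
   [L p], along which [|v|^2 + c <L p, p>] alone is only nonincreasing. *)
Definition lyap (c eps : R) (p v : V) : R :=
  ip v v + c * ip (L p) p + eps * ip (L p) v.

(** Coercivity: by Young and [norm_L_le] the cross term costs at most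
    [eps / 2 * |v|^2 + eps * <L p, p>], that is, half of each main term. *)
Lemma lyap_ge (c eps : R) p v : 0 <= eps <= 1 -> 2 * eps <= c ->
  2^-1 * ip v v + c / 2 * ip (L p) p <= lyap c eps p v.
Proof.
move=> /andP[e0 e1] ec; rewrite /lyap.
have /andP[Y _] := form_young (L p) v (@ltr01 R).
move: Y; rewrite invr1 !mul1r => Y; have B := norm_L_le p.
have := L_ge0 p; have := ip_ge0 v; nra.
Qed.

Lemma lyap_le (c eps : R) p v : 0 <= eps <= 1 -> 0 <= c ->
  lyap c eps p v <= (2 * c + 2) * (ip p p + ip v v).
Proof.
move=> /andP[e0 e1] ec; rewrite /lyap.
have /andP[_ Y] := form_young (L p) v (@ltr01 R).
move: Y; rewrite invr1 !mul1r => Y; have B := norm_L_le p.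
have := L_ge0 p; have := ip_ge0 v; have := ip_ge0 p; have := L_le2 p; nra.
Qed.

(** Young's inequality for the energy, itself a nonnegative quadratic form: expand it at
    [eta (p, v) - (p', v')]. It separates the forcing [alpha] from the contraction. *)
Lemma lyap_add (c eps eta : R) p v p' v' : 0 <= eps <= 1 -> 2 * eps <= c -> 0 < eta ->
  lyap c eps (p + p') (v + v') <=
  (1 + eta) * lyap c eps p v + (1 + eta^-1) * lyap c eps p' v'.
Proof.
move=> e01 ec h0.
have hi : eta * eta^-1 = 1 by rewrite divff // gt_eqF.
have c0 : 0 <= c by case/andP: e01 => e0 _; lra.
have P x y : 0 <= lyap c eps x y.
  apply: le_trans (lyap_ge _ _ e01 ec).
  by rewrite addr_ge0 // mulr_ge0 ?divr_ge0 ?invr_ge0.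
have iv : 0 <= eta^-1 by rewrite invr_ge0 ltW.
have := mulr_ge0 iv (P (eta *: p + (-1) *: p') (eta *: v + (-1) *: v')).
rewrite /lyap !ipE (ipC v' v) (L_sym p' p).
set X1 := ip v v; set X2 := ip v v'; set X3 := ip v' v'.
set X4 := ip (L p) p; set X5 := ip (L p) p'; set X6 := ip (L p') p'.
set X7 := ip (L p) v; set X8 := ip (L p) v'; set X9 := ip (L p') v.
set X10 := ip (L p') v'.
move=> H; rewrite -subr_ge0; apply: (le_trans H); rewrite le_eqVlt; apply/orP; left; apply/eqP.
rewrite [RHS](_ : _ = (eta * (X1 + c * X4 + eps * X7) - (2 * X2 + 2 * c * X5 + eps * (X8 + X9)) + eta^-1 * (X3 + c * X6 + eps * X10))); last by ring.
rewrite [LHS](_ : _ = (eta * eta^-1) * (eta * (X1 + c * X4 + eps * X7)) - (eta * eta^-1) * (2 * X2 + 2 * c * X5 + eps * (X8 + X9)) + eta^-1 * (X3 + c * X6 + eps * X10)); last by ring.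
by rewrite hi !mul1r.
Qed.

Variables (K : R).
Hypothesis K_gt0 : 0 < K.
Hypothesis gap : forall x, ip (L x) x <= K * ip (L x) (L x).

(* The step is written in the coordinates [w = v + v'] and [L p], in which the energy
   [|v|^2 + (2 b / h) <L p, p>] drops by [(2 a - 1) |w|^2 - (b h / 2) <L w, w>],
   the mixed terms [<L p, w>] cancelling. *)
Lemma lyap_contract (a b h : R) : 0 < h -> 0 < b -> b * h < 2 * a - 1 ->
  exists eps rho : R, [/\ 0 < eps <= 1, 2 * eps <= 2 * b / h, 0 < rho < 1 &
    forall p w,
      lyap (2 * b / h) eps (p + (h / 2) *: w) ((1 - a) *: w + (- b) *: L p) <=
      rho * lyap (2 * b / h) eps p (a *: w + b *: L p)].
Proof.
move=> h0 b0 abh; set c := 2 * b / h.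
have ch : c * h = 2 * b by rewrite /c mulfVK // gt_eqF.
have c0 : 0 < c by rewrite /c divr_gt0 // mulr_gt0.
have a0 : 2 * a - 1 > 0 by apply: lt_trans abh; rewrite mulr_gt0.
set g := 2 * a - 1 - b * h; have g0 : 0 < g by rewrite /g subr_gt0.
(* The [|w|^2] cost of the change in the cross term, one summand from each of [Z1], [t1] and [t2]
   below. *)
set C1 := (2 * a - 1) ^+ 2 / (2 * b) + h * a + h ^+ 2 * b / 2.
have C10 : 0 < C1.
  have : 0 <= (2 * a - 1) ^+ 2 / (2 * b) by rewrite divr_ge0 ?sqr_ge0 // mulr_ge0 ?ltW.
  have : 0 < h * a by rewrite mulr_gt0 //; lra.
  have : 0 < h ^+ 2 * b / 2 by rewrite divr_gt0 // mulr_gt0 ?exprn_gt0.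
  rewrite /C1; lra.
(* The bounds 1 and [c / 2] serve coercivity; the third lets the cross term spend at most half of
   the margin [g]. *)
set eps := Num.min (Num.min 1 (c / 2)) (g / (2 * C1)).
have eps0 : 0 < eps by rewrite !lt_min ltr01 !divr_gt0 // mulr_gt0.
have eps1 : eps <= 1 by rewrite !ge_min lexx.
have epsc : eps <= c / 2 by rewrite !ge_min lexx orbT.
have epsg : eps * C1 <= g / 2.
  have : eps <= g / (2 * C1) by rewrite ge_min lexx orbT.
  move=> H; have := ler_wpM2r (ltW C10) H.
  by have -> // : g / (2 * C1) * C1 = g / 2 by field; rewrite gt_eqF.
(* Guaranteed drop per unit of [|w|^2 + |L p|^2]: the other half of [g] in the direction [w], and
   [eps * b] in the direction [L p]. *)
set m := Num.min (g / 2) (eps * b).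
have m0 : 0 < m by rewrite lt_min divr_gt0 // mulr_gt0.
have mg : m <= g / 2 by rewrite ge_min lexx.
have mb : m <= eps * b by rewrite ge_min lexx orbT.
(* By the gap, [C2 * (|w|^2 + |L p|^2)] dominates the old energy; the summand [m] keeps the ratio
   [1 - m / C2] positive. *)
set C2 := 3 * (a ^+ 2 + b ^+ 2) + c * K + 1 + m.
have C20 : 0 < C2.
  have := sqr_ge0 a; have := sqr_ge0 b; have := mulr_gt0 c0 K_gt0; rewrite /C2; lra.
have mC : m < C2.
  have := sqr_ge0 a; have := sqr_ge0 b; have := mulr_gt0 c0 K_gt0; rewrite /C2; lra.
exists eps, (1 - m / C2); split.
- by rewrite eps0.
- by lra.
- have : 0 < m / C2 by rewrite divr_gt0.
  have : m / C2 < 1 by rewrite ltr_pdivrMr // mul1r.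
  lra.
move=> p w; set q := L p.
set X := ip w w; set Y := ip q q; set Z := ip q w; set A := ip q p.
set T := ip (L w) w; set U := ip (L w) q.
have X0 : 0 <= X := ip_ge0 _.
have Y0 : 0 <= Y := ip_ge0 _.
have T0 : 0 <= T := L_ge0 _.
have T2 : T <= 2 * X := L_le2 _.
have A0 : 0 <= A := L_ge0 _.
have AY : A <= K * Y := gap _.
have U1 : - U * 2 <= 2 * (h * X + h^-1 * Y).
  have := L_ge0 (h *: w + q); rewrite !ipE (L_sym q w) -/T -/U => H1.
  have Q2 : ip (L q) q <= 2 * Y := L_le2 _.
  have hi : h * h^-1 = 1 by rewrite divff // gt_eqF.
  have iv : 0 <= h^-1 by rewrite invr_ge0 ltW.
  have := mulr_ge0 iv H1.
  rewrite [X in 0 <= X](_ : _ = (h * h^-1) * (h * T) + 2 * (h * h^-1) * U + h^-1 * ip (L q) q); last by ring.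
  rewrite hi; have := ler_wpM2l iv Q2; have := ler_wpM2l (ltW h0) T2; nra.
(* The Young weights are set to cost only [b / 2 * Y]. With another [b / 2 * Y] from [t2], the term
   [- 2 * b * Y] still leaves [- b * Y]. *)
have Z1 : - ((2 * a - 1) * Z) <= b / 2 * Y + (2 * a - 1) ^+ 2 / (2 * b) * X.
  have := ip_ge0 ((2 * a - 1) *: w + b *: q); rewrite !ipE (ipC w q) -/X -/Y -/Z => H.
  have iv : 0 < (2 * b)^-1 by rewrite invr_gt0 mulr_gt0.
  have := mulr_ge0 (ltW iv) H.
  rewrite [X in 0 <= X](_ : _ = ((2 * a - 1) ^+ 2 * (2 * b)^-1) * X + (2 * b * (2 * b)^-1) * ((2 * a - 1) * Z) + (2 * b * (2 * b)^-1) * (b / 2 * Y)); last by field; rewrite gt_eqF.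
  rewrite divff ?gt_eqF ?mulr_gt0 //; lra.
have up : lyap c eps p (a *: w + b *: L p) <= C2 * (X + Y).
  rewrite /lyap; set v := a *: w + b *: L p.
  have /andP[_ YY] := form_young (L p) v (@ltr01 R).
  move: YY; rewrite invr1 !mul1r -/q -/A -/Y => YY.
  have vv : ip v v <= 2 * (a ^+ 2 * X + b ^+ 2 * Y).
    have := ip_ge0 (a *: w + (- b) *: q).
    by rewrite /v !ipE -/q (ipC w q) -/X -/Y -/Z; lra.
  have v0 := ip_ge0 v.
  have cA : c * A <= c * K * Y by rewrite -mulrA ler_wpM2l // ltW.
  have cK : 0 < c * K by rewrite mulr_gt0.
  have e2 : eps * ip q v <= (Y + ip v v) / 2 by nra.
  rewrite /C2.
  have aX : 0 <= a ^+ 2 * X by rewrite mulr_ge0 ?sqr_ge0.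
  have bX : 0 <= b ^+ 2 * X by rewrite mulr_ge0 ?sqr_ge0.
  have aY : 0 <= a ^+ 2 * Y by rewrite mulr_ge0 ?sqr_ge0.
  have bY : 0 <= b ^+ 2 * Y by rewrite mulr_ge0 ?sqr_ge0.
  have ckX : 0 <= c * K * X by rewrite mulr_ge0 // ltW.
  have mX : 0 <= m * X by rewrite mulr_ge0 // ltW.
  have mY : 0 <= m * Y by rewrite mulr_ge0 // ltW.
  nra.
have down : lyap c eps (p + (h / 2) *: w) ((1 - a) *: w + (- b) *: L p) <=
    lyap c eps p (a *: w + b *: L p) - m * (X + Y).
  have -> : lyap c eps (p + (h / 2) *: w) ((1 - a) *: w + (- b) *: L p) =
    lyap c eps p (a *: w + b *: L p) - (2 * a - 1) * X - 2 * b * Z + (c * h) * Z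
    + (c * h) * (h / 4) * T + eps * (- ((2 * a - 1) * Z) - 2 * b * Y
      + h / 2 * (1 - a) * T - h / 2 * b * U).
    rewrite /lyap !ipE -/q (L_sym w p) -/q (ipC w q).
    rewrite -/X -/Y -/Z -/A -/T -/U; by field.
  rewrite ch.
  have E2 : - ((2 * a - 1) * Z) - 2 * b * Y + h / 2 * (1 - a) * T - h / 2 * b * U
     <= - (b * Y) + C1 * X.
    have t1 : h / 2 * (1 - a) * T <= h * a * X.
      have : h * (1 - a) * T <= h * a * (2 * X); last by lra.
      rewrite -!mulrA ler_pM2l //; nra.
    have t2 : - (h / 2 * b * U) <= h ^+ 2 * b / 2 * X + b / 2 * Y.
      have hb : 0 <= h * b by rewrite mulr_ge0 ?ltW.
      have := ler_wpM2l hb U1.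
      rewrite [X in _ <= X](_ : _ = 2 * (h ^+ 2 * b * X + (h / h) * (b * Y))); last by ring.
      rewrite divff ?gt_eqF //; lra.
    rewrite /C1; lra.
  have E3 := ler_wpM2l (ltW eps0) E2.
  have bT : b * h * T <= b * h * (2 * X) by rewrite ler_wpM2l // mulr_ge0 ?ltW.
  have eX : eps * C1 * X <= g / 2 * X by rewrite ler_wpM2r.
  have mX : m * X <= g / 2 * X by rewrite ler_wpM2r.
  have mY : m * Y <= eps * b * Y by rewrite ler_wpM2r.
  have gX : g * X = (2 * a - 1) * X - b * h * X by rewrite /g; ring.
  lra.
apply: (le_trans down); rewrite mulrBl mul1r lerD2l lerN2.
rewrite mulrAC -mulrA ler_wpM2l ?(ltW m0) //.
by rewrite ler_pdivrMr // mulrC.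
Qed.
(** The forced energy satisfies [E' <= rh * E + G * M * t ^+ k] with [rh < t], hence decays like
    [t ^+ k]. The constants precede [M] and the trajectory, so the estimate is uniform in the
    data. *)
Lemma lyap_decay (beta kappa h s : R) : 0 < h -> 0 < kappa -> beta < 2 ->
  kappa * h < beta -> 0 < s < 1 ->
  exists C t : R, [/\ 0 < C, s <= t, 0 < t < 1 &
    forall (M : R) (p v alpha : nat -> V), 0 <= M ->
      (forall k, p k.+1 = p k - alpha k.+1 + (h / 2) *: (v k + v k.+1)) ->
      (forall k, v k.+1 =
         (1 - beta) *: v k - kappa *: L (p k) + kappa *: alpha k.+1) ->
      ip (p 0%N) (p 0%N) + ip (v 0%N) (v 0%N) <= M ->
      (forall k, ip (alpha k.+1) (alpha k.+1) <= M * s ^+ k) ->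
      forall k, ip (v k) (v k) <= C * M * t ^+ k /\
        ip (L (p k)) (p k) <= C * M * t ^+ k].
Proof.
move=> h0 k0 b2 khb /andP[s0 s1].
have b2' : 0 < 2 - beta by rewrite subr_gt0.
have b2n : 2 - beta != 0 by rewrite gt_eqF.
(* Obtained by solving the unforced sum [w = v + v' = (2 - beta) v - kappa L p] for
   [v = a w + b L p]. *)
pose a := (2 - beta)^-1; pose b := kappa / (2 - beta).
have b0 : 0 < b by rewrite divr_gt0.
have abh : b * h < 2 * a - 1.
  rewrite -(ltr_pM2r b2') /a /b mulrBl mulfVK // mul1r mulrAC mulfVK //; lra.
have [eps [rho [/andP[e0 e1] ec /andP[rho0 rho1] contr]]] :=
  lyap_contract h0 b0 abh.
set c := 2 * b / h in ec contr.
have e01 : 0 <= eps <= 1 by rewrite e1 ltW.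
have c0 : 0 < c by rewrite /c divr_gt0 // mulr_gt0.
pose eta := (1 - rho) / 2; have eta0 : 0 < eta by rewrite divr_gt0 // subr_gt0.
pose rh := (1 + eta) * rho.
have rh1 : rh < 1 by rewrite /rh /eta; nra.
have rh0 : 0 < rh by rewrite mulr_gt0 // addr_gt0.
pose m := Num.max rh s.
have m1 : m < 1 by rewrite gt_max rh1.
have mr : rh <= m by rewrite le_max lexx.
have ms : s <= m by rewrite le_max lexx orbT.
(* The midpoint of [m] and 1 leaves a gap [t - rh] of at least [(1 - m) / 2] to absorb the
   forcing. *)
pose t := (1 + m) / 2.
(* Net coefficient of [alpha] in the position: -1 directly, [h / 2 * kappa] through the new
   velocity. *)
pose gam := h / 2 * kappa - 1.
pose G0 := 2 * c + 2; have G00 : 0 < G0 by rewrite /G0; lra.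
pose G := (1 + eta^-1) * (G0 * (gam ^+ 2 + kappa ^+ 2)).
have ei0 : 0 <= 1 + eta^-1 by rewrite addr_ge0 // invr_ge0 ltW.
have G_ge0 : 0 <= G.
  by rewrite /G mulr_ge0 // (mulr_ge0 (ltW G00)) // addr_ge0 ?sqr_ge0.
(* [G0] covers the initial energy; the second summand gives [rh * B + G <= t * B], which closes the
   induction. *)
pose B := G0 + G / ((1 - m) / 2).
have d0 : 0 < (1 - m) / 2 by rewrite divr_gt0 // subr_gt0.
have B0 : 0 < B by rewrite /B ltr_pwDl // divr_ge0 // ltW.
have GB : G <= (t - rh) * B.
  have Gd : G / ((1 - m) / 2) * ((1 - m) / 2) = G by rewrite mulfVK // gt_eqF.
  have : (1 - m) / 2 * B <= (t - rh) * B by apply: ler_wpM2r; [exact: ltW | rewrite /t; lra].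
  rewrite {1}/B mulrDr [X in _ + X]mulrC Gd.
  have := mulr_gt0 d0 G00; lra.
have t0 : 0 < t by rewrite /t; lra.
(* The factors 2 and [2 / c] undo [lyap_ge] for [|v|^2] and [<L p, p>] respectively. *)
pose C := (2 + 2 / c) * B.
have ci : 0 < c^-1 by rewrite invr_gt0.
exists C, t; split.
- by rewrite /C mulr_gt0 // addr_gt0 // divr_gt0.
- by rewrite /t; lra.
- by rewrite t0 /t; lra.
move=> M p v alpha M0 Hp Hv H0 Ha.
have main k : lyap c eps (p k) (v k) <= B * M * t ^+ k.
  elim: k => [|k IH].
    rewrite expr0 mulr1; apply: (le_trans (lyap_le _ _ e01 (ltW c0))).
    apply: (@le_trans _ _ (G0 * M)); first by rewrite ler_wpM2l // ltW.
    by rewrite ler_wpM2r // /B lerDl divr_ge0 // ltW.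
  pose w := (2 - beta) *: v k - kappa *: L (p k).
  have Ev : a *: w + b *: L (p k) = v k.
    rewrite /w scalerBr !scalerA -addrA -scaleNr -scalerDl.
    by rewrite /a /b mulVf // scale1r mulrC addNr scale0r addr0.
  have Ev' : (1 - a) *: w + (- b) *: L (p k) = (1 - beta) *: v k - kappa *: L (p k).
    rewrite scalerBl scale1r scaleNr -addrA -opprD Ev /w addrAC.
    by rewrite -[X in _ - X - _](scale1r (v k)) -scalerBl; congr (_ *: _ - _); ring.
  have Evk : v k.+1 = ((1 - a) *: w + (- b) *: L (p k)) + kappa *: alpha k.+1.
    by rewrite Hv Ev'.
  have Ew : v k + v k.+1 = w + kappa *: alpha k.+1.
    rewrite Hv /w addrA addrA -{1}(scale1r (v k)) -scalerDl.
    by congr (_ *: _ - _ + _); ring.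
  have Epk : p k.+1 = (p k + (h / 2) *: w) + gam *: alpha k.+1.
    rewrite Hp Ew scalerDr scalerA -!addrA; congr (_ + _).
    rewrite addrCA; congr (_ + _).
    by rewrite /gam scalerBl scale1r addrC.
  rewrite Evk Epk.
  apply: (le_trans (lyap_add _ _ _ _ e01 _ eta0)) => //.
  have T1 : lyap c eps (p k + (h / 2) *: w) ((1 - a) *: w + - b *: L (p k)) <=
      rho * (B * M * t ^+ k).
    by apply: (le_trans (contr _ _)); rewrite Ev ler_wpM2l // ltW.
  have T2 : (1 + eta^-1) * lyap c eps (gam *: alpha k.+1) (kappa *: alpha k.+1) <=
      G * (M * t ^+ k).
    rewrite /G -[leRHS]mulrA ler_wpM2l //.
    apply: (le_trans (lyap_le _ _ e01 (ltW c0))).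
    rewrite -mulrA ler_wpM2l ?(ltW G00) // !ipE !mulrA -!expr2 -mulrDl -mulrA.
    rewrite ler_wpM2l ?addr_ge0 ?sqr_ge0 // (le_trans (Ha k)) // ler_wpM2l //.
    by rewrite lerXn2r ?nnegrE ?(ltW s0) ?(ltW t0) // /t; lra.
  have T3 : 0 <= 1 + eta by rewrite addr_ge0 // ltW.
  apply: (le_trans (lerD (ler_wpM2l T3 T1) T2)).
  have Mt : 0 <= M * t ^+ k by rewrite mulr_ge0 // exprn_ge0 // ltW.
  have := ler_wpM2r Mt GB; rewrite exprS.
  rewrite [(1 + eta) * _](_ : _ = rh * (B * (M * t ^+ k))); last by rewrite /rh; ring.
  lra.
move=> k; have Lk := le_trans (lyap_ge (p k) (v k) e01 ec) (main k).
have V0 := ip_ge0 (v k); have A0 := L_ge0 (p k).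
have V1 : ip (v k) (v k) <= 2 * (B * M * t ^+ k).
  have : 0 <= c / 2 * ip (L (p k)) (p k) by rewrite mulr_ge0 // divr_ge0 // ltW.
  lra.
have A1 : ip (L (p k)) (p k) <= 2 / c * (B * M * t ^+ k).
  rewrite -mulrA -(ler_pM2l c0) !mulrA (mulrAC c) mulfV ?gt_eqF //; lra.
have BM : 0 <= B * M * t ^+ k by rewrite !mulr_ge0 ?exprn_ge0 // ltW.
have cB : 0 <= 2 / c * (B * M * t ^+ k) by rewrite mulr_ge0 // divr_ge0 // ltW.
rewrite /C; split; lra.
Qed.
End Lyapunov.

(** * The normalised graph Laplacian *)

Section GraphLaplacian.
Variables (R : realType) (I : finType) (e : rel I).
Implicit Types x y : I -> R^o.

Definition deg i : R := #|[pred j | e i j]|%:R.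
(** The degree weights make the random-walk Laplacian [I - D^-1 A] self-adjoint. Values in [R^o]
    turn the function space into the [lmodType] of the Lyapunov section. *)
Definition dot (x y : I -> R^o) : R := \sum_i deg i * x i * y i.
Definition lap (x : I -> R^o) : I -> R^o := fun i => x i - (\sum_(j | e i j) x j) / deg i.

Lemma dotC x y : dot x y = dot y x.
Proof. by apply: eq_bigr => i _; rewrite mulrAC. Qed.

Lemma dotDl x y z : dot (x + y) z = dot x z + dot y z.
Proof. by rewrite -big_split; apply: eq_bigr => i _; rewrite mulrDr mulrDl. Qed.

Lemma dotZl a x y : dot (a *: x) y = a * dot x y.
Proof.
by rewrite mulr_sumr; apply: eq_bigr => i _; rewrite !mulrA (mulrC a) .
Qed.

Lemma dot_ge0 x : 0 <= dot x x.
Proof.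
by apply: sumr_ge0 => i _; rewrite -mulrA mulr_ge0 ?ler0n // -expr2 sqr_ge0.
Qed.

Lemma lapD x y : lap (x + y) = lap x + lap y.
Proof.
apply/funext => i; rewrite /lap !fctE.
have -> : \sum_(j | e i j) (x j + y j) = \sum_(j | e i j) x j + \sum_(j | e i j) y j.
  by rewrite big_split.
ring.
Qed.

Lemma lapZ a x : lap (a *: x) = a *: lap x.
Proof.
apply/funext => i; rewrite /lap !fctE.
have -> : \sum_(j | e i j) (a *: x j) = a * \sum_(j | e i j) x j.
  by rewrite mulr_sumr.
by rewrite scalerBr [in RHS]/GRing.scale /= mulrA.
Qed.

Hypothesis e_sym : symmetric e.
Hypothesis e_ex : forall i, exists j, e i j.
Hypothesis e_conn : forall i j, connect e i j.

Lemma deg_ge1 i : 1 <= deg i.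
Proof.
by rewrite /deg ler1n; have [j eij] := e_ex i; apply/card_gt0P; exists j.
Qed.

Lemma deg_neq0 i : deg i != 0.
Proof. by rewrite gt_eqF // (lt_le_trans _ (deg_ge1 i)). Qed.

Lemma sum_deg x : \sum_i deg i * x i = \sum_i \sum_(j | e i j) x i.
Proof.
by apply: eq_bigr => i _; rewrite sumr_const mulr_natl.
Qed.

Lemma exchange_edges (F : I -> I -> R) :
  \sum_i \sum_(j | e i j) F i j = \sum_i \sum_(j | e i j) F j i.
Proof.
rewrite (exchange_big_dep predT) //=; apply: eq_bigr => i _.
by apply: eq_bigl => j; rewrite e_sym.
Qed.

Lemma dot_lap x y :
  dot (lap x) y = \sum_i \sum_(j | e i j) (x i - x j) * y i.
Proof.
apply: eq_bigr => i _; rewrite -mulr_suml; congr (_ * _).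
rewrite /lap mulrBr [X in _ - X]mulrC mulfVK ?deg_neq0 // sumrB.
by rewrite sumr_const mulr_natl.
Qed.

(** The Dirichlet form: averaging over the two orientations of each edge makes the expression
    symmetric in [x] and [y]. *)
Lemma dot_lap2 x y :
  2 * dot (lap x) y = \sum_i \sum_(j | e i j) (x i - x j) * (y i - y j).
Proof.
rewrite mulr_natl mulr2n {2}dot_lap exchange_edges dot_lap -big_split /=.
apply: eq_bigr => i _; rewrite -big_split; apply: eq_bigr => j _ /=; ring.
Qed.

Lemma lap_sym x y : dot (lap x) y = dot (lap y) x.
Proof.
apply: (@mulfI _ 2); first by rewrite pnatr_eq0.
by rewrite !dot_lap2; apply: eq_bigr => i _; apply: eq_bigr => j _; rewrite mulrC.
Qed.

Lemma edge_le x i j : e i j -> (x i - x j) ^+ 2 <= 2 * dot (lap x) x.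
Proof.
move=> eij; rewrite dot_lap2 (bigD1 i) //= (bigD1 j) //= -addrA -expr2 lerDl.
by rewrite addr_ge0 // !(sumr_ge0, mulr_ge0) // => *; rewrite ?sumr_ge0 // => *;
  rewrite -expr2 sqr_ge0.
Qed.

Lemma lap_ge0 x : 0 <= dot (lap x) x.
Proof.
rewrite -(@pmulr_rge0 _ 2) ?ltr0n // dot_lap2.
by apply: sumr_ge0 => i _; apply: sumr_ge0 => j _; rewrite -expr2 sqr_ge0.
Qed.

Lemma lap_le2 x : dot (lap x) x <= 2 * dot x x.
Proof.
rewrite -(@ler_pM2l _ 2) ?ltr0n // dot_lap2.
have E : dot x x = \sum_i \sum_(j | e i j) x i ^+ 2.
  by rewrite -(sum_deg (fun i => x i ^+ 2)); apply: eq_bigr => i _; rewrite -mulrA.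
have -> : 2 * (2 * dot x x) =
    \sum_i \sum_(j | e i j) (2 * x i ^+ 2 + 2 * x j ^+ 2).
  transitivity (2 * dot x x + 2 * dot x x); first by ring.
  rewrite {1}E {1}(exchange_edges (fun i j => x i ^+ 2)) E !mulr_sumr -big_split.
  apply: eq_bigr => i _; rewrite !mulr_sumr -big_split /=.
  by apply: eq_bigr => j _; rewrite addrC.
apply: ler_sum => i _; apply: ler_sum => j _.
have := sqr_ge0 (x i + x j); nra.
Qed.

(* The constant doubles at every edge of a path; only its existence matters. *)
Lemma osc_le : exists2 K : R, 0 < K &
  forall (x : I -> R^o) i j, (x i - x j) ^+ 2 <= K * dot (lap x) x.
Proof.
have P i j : exists2 K : R, 0 <= K & forall x, (x i - x j) ^+ 2 <= K * dot (lap x) x.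
  have /connectP[p ep ->] := e_conn i j; elim: p i ep => [|k p IH] i /=.
    by exists 0 => // x; rewrite subrr expr0n mul0r.
  case/andP=> eik /IH[K K0 HK]; exists (4 + 2 * K) => [|x].
    by rewrite addr_ge0 // mulr_ge0.
  have := HK x; have := edge_le x eik; set z := x (last k p).
  have := sqr_ge0 ((x i - x k) - (x k - z)); nra.
have Q i : exists f : I -> R, forall j, 0 <= f j /\
    forall x, (x i - x j) ^+ 2 <= f j * dot (lap x) x.
  apply: (fin_all_exists (P := fun j K => 0 <= K /\
    forall x, (x i - x j) ^+ 2 <= K * dot (lap x) x)) => j.
  by have [K ? ?] := P i j; exists K.
have [f fP] := fin_all_exists Q.
have f0 i j : 0 <= f i j by case: (fP i j).
have s0 i : 0 <= \sum_j f i j by apply: sumr_ge0.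
exists (1 + \sum_i \sum_j f i j) => [|x i j].
  by rewrite ltr_pwDl // sumr_ge0.
have [_ /(_ x)/le_trans] := fP i j; apply; apply: ler_wpM2r; first exact: lap_ge0.
rewrite (bigD1 i) //= (bigD1 j) //=.
have : 0 <= \sum_(k | k != j) f i k by apply: sumr_ge0.
have : 0 <= \sum_(l | l != i) \sum_k f l k by apply: sumr_ge0.
lra.
Qed.

(** A Poincare inequality without eigenvalues: constants lie in the kernel, so [x] may be replaced
    by [y = x - x i0], whose norm [osc_le] bounds by [<L x, x>]; Young applied to [<L x, y>] then
    absorbs half of the left side. *)
Lemma lap_gap : exists2 K : R, 0 < K &
  forall x, dot (lap x) x <= K * dot (lap x) (lap x).
Proof.
have [K K0 KP] := osc_le.
set D := \sum_i deg i; have D0 : 0 <= D by apply: sumr_ge0 => i _; rewrite ler0n.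
have DK : 0 < D * K + 1 by rewrite ltr_wpDl // mulr_ge0 // ltW.
exists (D * K + 1) => // x.
(* A base vertex is needed; for empty [I] the left side is an empty sum. *)
case: (pickP (fun _ : I => true)) => [i0 _|no]; last first.
  rewrite {1}/dot big1 => [|i]; first by rewrite mulr_ge0 ?dot_ge0 ?ltW.
  by have := no i.
set y := fun i => x i - x i0.
have E : dot (lap x) x = dot (lap x) y.
  apply: (@mulfI _ 2); first by rewrite pnatr_eq0.
  rewrite !dot_lap2; apply: eq_bigr => i _; apply: eq_bigr => j _.
  by rewrite /y; ring.
have yy : dot y y <= (D * K + 1) * dot (lap x) x.
  have : dot y y <= D * K * dot (lap x) x.
    rewrite -mulrA mulr_suml; apply: ler_sum => i _.
    by rewrite -mulrA ler_wpM2l ?ler0n // -expr2 KP.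
  by move=> /le_trans; apply; rewrite ler_wpM2r ?lap_ge0 // lerDl.
have /andP[_] := form_young dotC dotDl dotZl dot_ge0 (lap x) y DK.
rewrite -E => H.
have : (D * K + 1)^-1 * dot y y <= dot (lap x) x by rewrite ler_pdivrMl.
lra.
Qed.

End GraphLaplacian.

(** * The one-step optimisation problem *)

Section OneStep.
Variables (R : realType) (N : nat) (e : rel 'I_N) (w1 w2 w3 h : R).
Hypothesis e_ex : forall i, exists j, e i j.
Hypotheses (w1_gt0 : 0 < w1) (w2_gt0 : 0 < w2) (w3_gt0 : 0 < w3) (h_gt0 : 0 < h).

(* [curv] is half the second derivative of the cost in [u]; eliminating the unconstrained
   minimiser gives [v' = (1 - vgain) v - pgain (L p - alpha)], with [L] = [lap e]. *)
Definition curv : R := w3 + w2 * h ^+ 2 + w1 * h ^+ 4 / 4.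
Definition vgain : R := (w1 * h ^+ 4 / 2 + w2 * h ^+ 2) / curv.
Definition pgain : R := w1 * h ^+ 3 / (2 * curv).

(** The zero of the derivative of the cost in [u]; the neighbours enter only through their mean. *)
Definition uopt (prev : 'I_N -> R) (i : 'I_N) (x0 v0 : R) : R :=
  - (w1 * h ^+ 2 / 2 * (x0 + h * v0 - (\sum_(j | e i j) prev j) / deg R e i)
     + w2 * h * v0) / curv.

Lemma curv_gt0 : 0 < curv.
Proof. by rewrite /curv !addr_gt0 ?divr_gt0 ?mulr_gt0 ?exprn_gt0. Qed.

Lemma pgain_gt0 : 0 < pgain.
Proof. by rewrite divr_gt0 ?mulr_gt0 ?exprn_gt0 ?curv_gt0. Qed.

Lemma vgain_lt2 : vgain < 2.
Proof.
have h2 : 0 < w2 * h ^+ 2 by rewrite mulr_gt0 ?exprn_gt0.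
have h3 := w3_gt0; rewrite ltr_pdivrMr ?curv_gt0 // /curv; lra.
Qed.

(** The difference [vgain - pgain * h] is [w2 * h ^+ 2 / curv], so the velocity penalty supplies the
    strict margin of the contraction. *)
Lemma pgain_vgain : pgain * h < vgain.
Proof.
have h2 : 0 < w2 * h ^+ 2 by rewrite mulr_gt0 ?exprn_gt0.
have -> : pgain * h = (w1 * h ^+ 4 / 2) / curv.
  by rewrite /pgain; field; rewrite gt_eqF ?curv_gt0.
by rewrite ltr_pM2r ?invr_gt0 ?curv_gt0 // ltrDl.
Qed.

(** Completing the square: the Taylor expansion at [uopt] is exact and its linear term vanishes. *)
Lemma mpc_costE (prev : 'I_N -> R) i x0 v0 u :
  mpc_cost e w1 w2 w3 h prev i x0 v0 u =
  mpc_cost e w1 w2 w3 h prev i x0 v0 (uopt prev i x0 v0) +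
  curv * (u - uopt prev i x0 v0) ^+ 2.
Proof.
have dn0 := deg_neq0 R e_ex i; have Sn0 := gt_eqF curv_gt0.
set us := uopt prev i x0 v0; set s := \sum_(j | e i j) prev j.
have sq x : \sum_(j | e i j) (x - prev j) ^+ 2 =
    deg R e i * x ^+ 2 - 2 * x * s + \sum_(j | e i j) prev j ^+ 2.
  rewrite /deg -sumr_const mulr_suml mulr_sumr -sumrB -big_split.
  by apply: eq_bigr => j _ /=; ring.
(* Half the derivative of the cost at [us]. *)
have first_order : w1 * (h ^+ 2 / 2) * (next_pos h x0 v0 us - s / deg R e i)
    + w2 * h * next_vel h v0 us + w3 * us = 0.
  rewrite /next_pos /next_vel.
  have -> : us = - (w1 * h ^+ 2 / 2 * (x0 + h * v0 - s / deg R e i)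
     + w2 * h * v0) / curv by [].
  have := curv_gt0; rewrite /curv => S0; field.
  by apply/andP; split=> //; rewrite gt_eqF //; lra.
rewrite /mpc_cost -/(deg R e i) !sq.
set x := next_pos h x0 v0 us in first_order *.
have -> : next_pos h x0 v0 u = x + h ^+ 2 / 2 * (u - us).
  by rewrite /x /next_pos; ring.
have -> : next_vel h v0 u = next_vel h v0 us + h * (u - us).
  by rewrite /next_vel; ring.
set t := u - us; have -> : u = us + t by rewrite /t; ring.
apply/eqP; rewrite -subr_eq0; apply/eqP.
transitivity (2 * t * (w1 * (h ^+ 2 / 2) * (x - s / deg R e i)
    + w2 * h * next_vel h v0 us + w3 * us)); last by rewrite first_order mulr0.
by rewrite /curv; field.
Qed.

Lemma mpc_opt_uopt (vmin vmax amax : 'I_N -> R) prev i x0 v0 u :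
  mpc_feasible h (vmin i) (vmax i) (amax i) v0 (uopt prev i x0 v0) ->
  mpc_opt e w1 w2 w3 h vmin vmax amax prev i x0 v0 u <-> u = uopt prev i x0 v0.
Proof.
move=> feas; split=> [[_ /(_ _ feas)]|->].
  rewrite mpc_costE gerDl pmulr_rle0 ?curv_gt0 // => le0.
  by apply/eqP; rewrite -subr_eq0 -sqrf_eq0 eq_le le0 sqr_ge0.
split=> // u' _; rewrite (mpc_costE _ _ _ _ u') lerDl.
by rewrite mulr_ge0 ?sqr_ge0 ?ltW ?curv_gt0.
Qed.

Definition step (alpha : 'I_N -> R) (s : ('I_N -> R) * ('I_N -> R)) :=
  let u i := uopt s.1 i (s.1 i - alpha i) (s.2 i) in
  ((fun i => next_pos h (s.1 i - alpha i) (s.2 i) (u i)),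
   (fun i => next_vel h (s.2 i) (u i))).

Fixpoint traj (D0 dD0 : 'I_N -> R) (alpha : nat -> 'I_N -> R) k :=
  if k is k'.+1 then step (alpha k) (traj D0 dD0 alpha k') else (D0, dD0).

(** The acceleration is constant over a period, so the position moves by [h] times the mean of the
    end velocities; this eliminates [u]. *)
Lemma step_pos alpha s i :
  (step alpha s).1 i = s.1 i - alpha i + h / 2 * (s.2 i + (step alpha s).2 i).
Proof. by rewrite /step /next_pos /next_vel /=; field. Qed.

Lemma step_vel alpha s i :
  (step alpha s).2 i =
  (1 - vgain) * s.2 i - pgain * lap e s.1 i + pgain * alpha i.
Proof.
rewrite /step /next_vel /uopt /vgain /pgain /lap /=.
have dn0 := deg_neq0 R e_ex i; have Sn0 := gt_eqF curv_gt0.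
by field; rewrite dn0 Sn0.
Qed.

End OneStep.

(** * Decay of the unconstrained trajectory *)

Section Trajectory.
Variables (R : realType) (N : nat) (e : rel 'I_N) (w1 w2 w3 h nu : R).
Hypotheses (e_sym : symmetric e) (e_ex : forall i, exists j, e i j)
  (e_conn : forall i j, connect e i j).
Hypotheses (w1_gt0 : 0 < w1) (w2_gt0 : 0 < w2) (w3_gt0 : 0 < w3) (h_gt0 : 0 < h)
  (nu_gt0 : 0 < nu).

Let T := traj e w1 w2 w3 h.

Lemma dot_le (x : 'I_N -> R) b : (forall i, `|x i| <= b) ->
  dot e x x <= (\sum_i deg R e i) * b ^+ 2.
Proof.
move=> xb; rewrite mulr_suml; apply: ler_sum => i _.
rewrite -mulrA ler_wpM2l ?ler0n // -expr2 -(@real_normK _ (x i)) ?num_real //.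
by rewrite lerXn2r ?nnegrE // (le_trans _ (xb i)).
Qed.

Lemma sqr_le_dot (x : 'I_N -> R) i : x i ^+ 2 <= dot e x x.
Proof.
rewrite /dot (bigD1 i) //= -mulrA -expr2.
have : 0 <= \sum_(j | j != i) deg R e j * x j * x j.
  by apply: sumr_ge0 => j _; rewrite -mulrA mulr_ge0 ?ler0n // -expr2 sqr_ge0.
have := deg_ge1 R e_ex i; have := sqr_ge0 (x i); nra.
Qed.

Lemma norm_le_sqrt (x a b t : R) k : 0 <= a -> 0 <= b -> 0 <= t ->
  x ^+ 2 <= a * b ^+ 2 * t ^+ k -> `|x| <= Num.sqrt a * b * Num.sqrt t ^+ k.
Proof.
move=> a0 b0 t0 H; rewrite -(@ler_pXn2r _ 2) ?nnegrE //; last first.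
  by rewrite !mulr_ge0 ?exprn_ge0 ?sqrtr_ge0.
rewrite real_normK ?num_real // (le_trans H) // !exprMn sqr_sqrtr //.
by rewrite -exprM mulnC exprM sqr_sqrtr.
Qed.

(** [C] and [r] are fixed before the data and the bounds are linear in [mu], so small data keep the
    whole trajectory small. *)
Lemma traj_decay : exists C r : R, [/\ 0 < C, 0 < r < 1 &
  forall mu D0 dD0 alpha, 0 <= mu ->
    (forall i, `|D0 i| <= mu) -> (forall i, `|dD0 i| <= mu) ->
    (forall k i, (0 < k)%N -> `|alpha k i| <= mu * expR (- (nu * k%:R * h))) ->
    forall k, [/\ forall i, `|(T D0 dD0 alpha k).2 i| <= C * mu * r ^+ k,
      forall i j, `|(T D0 dD0 alpha k).1 i - (T D0 dD0 alpha k).1 j|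
        <= C * mu * r ^+ k &
      forall i, `|alpha k.+1 i| <= C * mu * r ^+ k]].
Proof.
pose sg := expR (- (nu * h)).
have sg0 : 0 < sg by exact: expR_gt0.
have sg1 : sg < 1 by rewrite expR_lt1 oppr_lt0 mulr_gt0.
have s01 : 0 < sg ^+ 2 < 1 by rewrite exprn_gt0 // expr_lt1 // ltW.
have [K K0 gap] := lap_gap R e_sym e_ex e_conn.
have [Ko Ko0 osc] := osc_le R e_sym e_ex e_conn.
have [C [t [C0 st /andP[t0 t1] decay]]] :=
  lyap_decay (dotC e) (dotDl e) (dotZl e) (@dot_ge0 R _ e) (lapD e) (lapZ e)
   (lap_sym e_sym e_ex) (lap_ge0 e_sym e_ex) (lap_le2 e_sym e_ex) K0 gap h_gt0
   (pgain_gt0 w1_gt0 w2_gt0 w3_gt0 h_gt0) (vgain_lt2 w1_gt0 w2_gt0 w3_gt0 h_gt0)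
   (pgain_vgain w1_gt0 w2_gt0 w3_gt0 h_gt0) s01.
set Sd := \sum_i deg R e i.
have Sd0 : 0 <= Sd by apply: sumr_ge0 => i _; rewrite ler0n.
(* [2 * Sd * mu ^+ 2] bounds the initial [|p|^2 + |v|^2]; [Ko] converts [<L p, p>] into
   disagreements. *)
pose Cv := C * (2 * Sd); pose Cp := Ko * Cv.
have Cv0 : 0 <= Cv by rewrite !mulr_ge0 // ltW.
have Cp0 : 0 <= Cp by rewrite mulr_ge0 // ltW.
have r0 : 0 < Num.sqrt t by rewrite sqrtr_gt0.
have sgr : sg <= Num.sqrt t.
  have -> : sg = Num.sqrt (sg ^+ 2) by rewrite sqrtr_sqr gtr0_norm.
  by apply: ler_wsqrtr.
(* Square roots, since the energy bounds squares; the summand 1 covers [alpha]. *)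
exists (Num.sqrt Cv + Num.sqrt Cp + 1), (Num.sqrt t); split.
- by rewrite ltr_wpDl // addr_ge0 ?sqrtr_ge0.
- by rewrite r0 -[ltRHS]sqrtr1 ltr_sqrt.
move=> mu D0 dD0 alpha mu0 HD HdD Ha k.
have Ha' l i : `|alpha l.+1 i| <= mu * sg ^+ l.
  apply: (le_trans (Ha l.+1 i isT)); rewrite ler_wpM2l //.
  rewrite -expRM_natl ler_expR mulrN lerN2 -mulrA [nu * (_ * _)]mulrCA.
  by rewrite ler_wpM2r ?ler_nat ?mulr_ge0 ?ltW.
have M0 : 0 <= 2 * Sd * mu ^+ 2 by rewrite !mulr_ge0 ?sqr_ge0.
have [] := decay (2 * Sd * mu ^+ 2) (fun k => (T D0 dD0 alpha k).1)
  (fun k => (T D0 dD0 alpha k).2) alpha M0 _ _ _ _ k.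
- by move=> l; apply/funext => i; exact: step_pos.
- by move=> l; apply/funext => i; exact: step_vel.
- by have := dot_le HD; have := dot_le HdD; rewrite /= -/Sd; lra.
- move=> l; apply: (le_trans (dot_le (Ha' l))).
  rewrite -/Sd exprMn mulrA -exprM mulnC exprM; apply: ler_wpM2r.
    by rewrite exprn_ge0 ?sqr_ge0.
  by have := mulr_ge0 Sd0 (sqr_ge0 mu); lra.
move=> Hv Hp.
have rk : 0 <= mu * Num.sqrt t ^+ k by rewrite mulr_ge0 // exprn_ge0 // ltW.
have sv := sqrtr_ge0 Cv; have sp := sqrtr_ge0 Cp.
rewrite -!mulrA; split.
- move=> i; apply: (@le_trans _ _ (Num.sqrt Cv * mu * Num.sqrt t ^+ k)).
    apply: norm_le_sqrt => //; first exact: ltW.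
    by rewrite (le_trans (sqr_le_dot _ i)) // (le_trans Hv) // /Cv !mulrA.
  by rewrite -mulrA ler_wpM2r //; lra.
- move=> i j; apply: (@le_trans _ _ (Num.sqrt Cp * mu * Num.sqrt t ^+ k)).
    apply: norm_le_sqrt => //; first exact: ltW.
    rewrite (le_trans (osc _ i j)) // /Cp /Cv -!mulrA ler_wpM2l ?(ltW Ko0) //.
    by rewrite (le_trans Hp) // !mulrA.
  by rewrite -mulrA ler_wpM2r //; lra.
- move=> i; apply: (@le_trans _ _ (mu * Num.sqrt t ^+ k)).
    apply: (le_trans (Ha' k i)); rewrite ler_wpM2l // lerXn2r ?nnegrE ?(ltW sg0) ?(ltW r0) //.
  by rewrite ler_peMl //; lra.
Qed.

End Trajectory.

(** * Trajectories generated by the constrained scheme *)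

Lemma exists_pos_lower_bound (R : realType) (I : finType) (F : I -> R) :
  (forall i, 0 < F i) -> exists2 m : R, 0 < m & forall i, m <= F i.
Proof.
(* The default 1 keeps the minimum positive even over an empty [I]. *)
move=> F0; exists (\big[Num.min/1]_i F i) => [|i]; last exact: bigmin_le_cond.
by apply: lt_bigmin.
Qed.

Lemma le_inf_norm (R : realType) (N : nat) (x : 'I_N -> R) i :
  `|x i| <= inf_norm x.
Proof. exact: (le_bigmax _ (fun i => `|x i|)). Qed.

Section Generated.
Variables (R : realType) (N : nat) (e : rel 'I_N) (w1 w2 w3 h : R)
  (vmin vmax amax D0 dD0 : 'I_N -> R) (alpha : nat -> 'I_N -> R).
Hypotheses (e_ex : forall i, exists j, e i j)
  (w1_gt0 : 0 < w1) (w2_gt0 : 0 < w2) (w3_gt0 : 0 < w3) (h_gt0 : 0 < h).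

Let T := traj e w1 w2 w3 h D0 dD0 alpha.
Let U k i := uopt e w1 w2 w3 h (T k).1 i ((T k).1 i - alpha k.+1 i) ((T k).2 i).

Hypothesis feasible : forall k i,
  mpc_feasible h (vmin i) (vmax i) (amax i) ((T k).2 i) (U k i).

(** The shift [k.-1] reflects that step [k] starts from state [k - 1]; at index 0 the scheme
    prescribes none of these three sequences. *)
Lemma traj_generated :
  mpc_generated e w1 w2 w3 h vmin vmax amax D0 dD0 alpha
    (fun k i => (T k.-1).1 i - alpha k i) (fun k => (T k.-1).2) (fun k => U k.-1)
    (fun k => (T k).1) (fun k => (T k).2).
Proof.
by split=> // k i; split=> //; apply/mpc_opt_uopt.
Qed.

(** By induction: equal states pose the same problem, whose minimiser is unique by strict
    convexity. *)
Lemma generated_traj d0 dd0 u d1 dd1 :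
  mpc_generated e w1 w2 w3 h vmin vmax amax D0 dD0 alpha d0 dd0 u d1 dd1 ->
  forall k, [/\ d1 k = (T k).1, dd1 k = (T k).2 & forall i, u k.+1 i = U k i].
Proof.
move=> [init gen].
have opt k i : d1 k = (T k).1 -> dd1 k = (T k).2 -> u k.+1 i = U k i.
  move=> E1 E2; have [E3 E4] := gen k i.
  rewrite E3 E4 E1 E2 => opt _ _.
  by move: opt => /(mpc_opt_uopt e_ex w1_gt0 w2_gt0 w3_gt0 h_gt0) ->.
elim=> [|k [E1 E2 E3]].
  have E1 : d1 0%N = D0 by apply/funext => i; case: (init i).
  have E2 : dd1 0%N = dD0 by apply/funext => i; case: (init i).
  by split=> // i; apply: opt.
have E1' : d1 k.+1 = (T k.+1).1.
  by apply/funext => i; have [-> -> _ -> _] := gen k i; rewrite E3 E1 E2.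
have E2' : dd1 k.+1 = (T k.+1).2.
  by apply/funext => i; have [_ -> _ _ ->] := gen k i; rewrite E3 E2.
by split=> // i; apply: opt.
Qed.

End Generated.

Theorem theorem2 (R : realType) (N : nat) (e : rel 'I_N)
  (w1 w2 w3 nu : R) (vmin vmax amax : 'I_N -> R) :
  (2 <= N)%N ->
  symmetric e -> irreflexive e -> (forall i j, connect e i j) ->
  (forall i : 'I_N, exists j, e i j) ->
  0 < w1 -> 0 < w2 -> 0 < w3 -> 0 < nu ->
  (forall i, vmin i < 0 < vmax i) -> (forall i, 0 < amax i) ->
  exists h0 : R, 0 < h0 /\
  forall h : R, 0 < h -> h < h0 ->
  exists nuh dh : R, 0 < nuh /\ 0 < dh /\
  forall (d : R) (D0 dD0 : 'I_N -> R) (alpha : nat -> 'I_N -> R),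
    0 < d -> d < dh ->
    (forall i, vmin i <= dD0 i <= vmax i) ->
    Num.max (inf_norm D0) (inf_norm dD0) < nuh ->
    (forall (k : nat) i, (0 < k)%N -> `|alpha k i| <= d * expR (- (nu * k%:R * h))) ->
    (exists d0 dd0 u d1 dd1 : nat -> 'I_N -> R,
        mpc_generated e w1 w2 w3 h vmin vmax amax D0 dD0 alpha d0 dd0 u d1 dd1) /\
    (forall d0 dd0 u d1 dd1 : nat -> 'I_N -> R,
        mpc_generated e w1 w2 w3 h vmin vmax amax D0 dD0 alpha d0 dd0 u d1 dd1 ->
        (forall (k : nat) i, (0 < k)%N ->
           vmin i <= dd1 k i <= vmax i /\ `|u k i| <= amax i) /\
        exists r M0 dM0 : R, [/\ 0 < r < 1, 0 < M0, 0 < dM0 &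
          forall (k : nat) (i j : 'I_N), (0 < k)%N ->
            `|d0 k i - d0 k j| <= M0 * r ^+ k /\ `|dd0 k i| <= dM0 * r ^+ k]).
Proof.
move=> _ e_sym _ e_conn e_ex w1_gt0 w2_gt0 w3_gt0 nu_gt0 v_bd a_gt0.
(* [m] is the smallest distance from 0 to a constraint bound, over all agents. *)
have [m m0 mP] : exists2 m : R, 0 < m & forall i,
    m <= Num.min (Num.min (- vmin i) (vmax i)) (amax i).
  apply: exists_pos_lower_bound => i; have /andP[v1 v2] := v_bd i.
  by rewrite !lt_min oppr_gt0 v1 v2 a_gt0.
exists 1; split=> // h h_gt0 _.
have [C [r [C0 /andP[r0 r1] decay]]] :=
  traj_decay e_sym e_ex e_conn w1_gt0 w2_gt0 w3_gt0 h_gt0 nu_gt0.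
(* The first bound keeps velocities within [m]; the second keeps [u = (v' - v) / h] within [m], as
   each velocity is at most [C * mu] in size. *)
pose mu := Num.min (m / C) (m * h / (2 * C)).
have mu0 : 0 < mu by rewrite lt_min !divr_gt0 ?mulr_gt0.
have muv : C * mu <= m by rewrite mulrC -ler_pdivlMr // ge_min lexx.
have mua : 2 * (C * mu) <= m * h.
  rewrite mulrA mulrC -ler_pdivlMr ?mulr_gt0 //.
  by rewrite ge_min lexx orbT.
exists mu, mu; do 2!split=> //.
move=> d D0 dD0 alpha d0 dmu _; rewrite gt_max => /andP[HD HdD] Ha.
set T := traj e w1 w2 w3 h D0 dD0 alpha.
have {}decay k : [/\ forall i, `|(T k).2 i| <= C * mu * r ^+ k,
    forall i j, `|(T k).1 i - (T k).1 j| <= C * mu * r ^+ k &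
    forall i, `|alpha k.+1 i| <= C * mu * r ^+ k].
  apply: decay => [|i|i|l i l0]; first exact: ltW.
  - exact: le_trans (le_inf_norm _ _) (ltW HD).
  - exact: le_trans (le_inf_norm _ _) (ltW HdD).
  - by apply: (le_trans (Ha l i l0)); rewrite ler_wpM2r ?expR_ge0 // ltW.
have Cr k : C * mu * r ^+ k <= C * mu.
  by rewrite ler_piMr ?exprn_ile1 ?mulr_ge0 // ltW.
have v_small k i : `|(T k).2 i| <= C * mu.
  by have [/(_ i) /le_trans -> //] := decay k.
have v_feas k i : vmin i <= (T k).2 i <= vmax i.
  have := le_trans (le_trans (v_small k i) muv) (mP i).
  rewrite !le_min !ler_norml => /andP[/andP[/andP[V1 _] /andP[_ V2]] _].
  by rewrite -[vmin i]opprK V1.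
pose U k i := uopt e w1 w2 w3 h (T k).1 i ((T k).1 i - alpha k.+1 i) ((T k).2 i).
have u_feas k i : `|U k i| <= amax i.
  have E : U k i = ((T k.+1).2 i - (T k).2 i) / h.
    by rewrite /= /next_vel -/(U k i); field; rewrite gt_eqF.
  have := mP i; rewrite !le_min => /andP[_ /(le_trans _)]; apply.
  rewrite E normrM normfV (gtr0_norm h_gt0) ler_pdivrMr //.
  apply: (le_trans (ler_normB _ _)); apply: le_trans mua.
  by rewrite mulr_natl mulr2n lerD.
have feas k i : mpc_feasible h (vmin i) (vmax i) (amax i) ((T k).2 i) (U k i).
  by split; [exact: v_feas | split; [exact: (v_feas k.+1) | exact: u_feas]].
split.
  do 5!eexists; exact: traj_generated.
move=> x0 v0 u x1 v1 gen.
have genT := generated_traj e_ex w1_gt0 w2_gt0 w3_gt0 h_gt0 feas gen.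
split=> [[//|k] i _|].
  have [_ -> _] := genT k.+1; have [_ _ ->] := genT k.
  by split; [exact: (v_feas k.+1) | exact: u_feas].
have Cm : 0 < C * mu by rewrite mulr_gt0.
(* The initial positions at step [k + 1] differ by one disagreement and two corrections, hence 3;
   dividing by [r] turns the rate at state [k] into [r ^+ k.+1]. *)
exists r, (3 * (C * mu) / r), (C * mu / r); split.
- by rewrite r0.
- by rewrite divr_gt0 // mulr_gt0.
- by rewrite divr_gt0.
move=> [//|k] i j _; have [_ Hg] := gen.
have [E1 E2 _] := genT k.
have [-> -> _ _ _] := Hg k i; have [-> _ _ _ _] := Hg k j.
rewrite E1 E2 exprS !mulrA !divfK ?gt_eqF // -!mulrA.
have [Hv Hp Hal] := decay k.
have := Hv i; have := Hp i j; have := Hal i; have := Hal j.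
rewrite -mulrA; set B := C * (mu * r ^+ k); rewrite !ler_norml.
move=> /andP[? ?] /andP[? ?] /andP[? ?] /andP[? ?].
by split; apply/andP; split; lra.
Qed.
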